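(* Let $\mathcal T$ be a finite rooted tree of depth $H$ in which each non-leaf node has at most $b$ children, and let $(X_m)_{m\ge0}$ be generated by the negative feedback algorithm on $\mathcal T$ starting at the root. Then, before all nodes have been visited at least once, each node is visited at most $2(b+1)H$ times.
   Context: Negative feedback algorithm: for an edge from $i$ to $j$, let $N_{ij}^{(m)}$ be the number of times $t<m$ with $X_t=i,X_{t+1}=j$. Let $Smin_i^{(m)}$ be the set of neighbours $j$ of $i$ minimizing $N_{ij}^{(m)}$. If $X_m=i$, then given the past, $X_{m+1}$ is uniformly distributed on $Smin_i^{(m)}$. *)

(* Defs.v *)
(* MathComp / MathComp-Analysis *)
From HB Require Import structures.
From mathcomp Require Import all_boot all_order all_algebra.
From mathcomp Require Import all_classical all_reals all_analysis.

Set Implicit Arguments.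
Unset Strict Implicit.
Unset Printing Implicit Defensive.

Import Order.TTheory GRing.Theory Num.Theory.

Section RootedTree.
Variables (V : finType) (e : rel V).

(* In a symmetric irreflexive relation, a duplicate-free closed walk of size at
   least 3 is exactly a graph cycle; those of size 2 traverse an edge back and
   forth. *)
Definition is_tree : Prop :=
  [/\ symmetric e, irreflexive e, (forall u v, connect e u v)
    & forall c : seq V, ucycle e c -> size c <= 2].

Definition walk (u v : V) (n : nat) : bool :=
  [exists p : n.-tuple V, path e u p && (last u p == v)].

(* Length of a shortest walk; the default value #|V| is only reached when u and
   v are not connected. *)
Definition gdist (u v : V) : nat := find (walk u v) (iota 0 #|V|).

Definition children (r v : V) : {set V} :=
  [set w | e v w && (gdist r w == (gdist r v).+1)]%SET.

Definition leaf (r v : V) : bool := children r v == finset.set0.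

Definition tree_depth (r : V) : nat := \max_(v : V) gdist r v.

End RootedTree.

Section Trajectory.
Variables (V : finType) (e : rel V) (x : nat -> V).

Definition crossings (m : nat) (i j : V) : nat :=
  #|[set t : 'I_m | (x t == i) && (x t.+1 == j)]%SET|.

Definition Smin (m : nat) (i : V) : {set V} :=
  [set j | e i j &&
     [forall k, e i k ==> (crossings m i j <= crossings m i k)]]%SET.

(* The time m itself is included in the two definitions below. *)
Definition visits (m : nat) (v : V) : nat :=
  #|[set t : 'I_m.+1 | x t == v]%SET|.

Definition covered (m : nat) : bool := [forall v : V, 0 < visits m v].

End Trajectory.

Section Process.
Local Open Scope classical_set_scope.
Local Open Scope ring_scope.

Variables (d : measure_display) (Omega : measurableType d) (R : realType).
Variable P : probability Omega R.

(* Meaningful only when P B != 0. *)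
Definition cprob (A B : set Omega) : R := fine (P (A `&` B)) / fine (P B).

Variables (V : finType) (e : rel V) (r : V) (X : nat -> Omega -> V).

Definition past (m : nat) (x : nat -> V) : set Omega :=
  [set w | forall t, (t <= m)%N -> X t w = x t].

(* "Given the past" is conditioning on each history X_0 = x_0, ..., X_m = x_m of
   positive probability; only the values x_0, ..., x_m of x matter.  The
   nonemptiness of Smin fails only when x_m has no neighbour, i.e. on the
   one-vertex tree, where no next step exists to be prescribed. *)
Definition negative_feedback : Prop :=
  [/\ forall m v, measurable [set w | X m w = v],
      {ae P, forall w, X 0%N w = r}
    & forall m x j, P (past m x) != 0%E -> Smin e x m (x m) != finset.set0 ->
        cprob [set w | X m.+1 w = j] (past m x) =
        if j \in Smin e x m (x m) then #|Smin e x m (x m)|%:R^-1 else 0].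

End Process.

(* Main.v *)
(* Almost surely the walk starts at the root r and always moves within Smin;
   the bound holds for every such trajectory.  Write N_ij for the crossing
   counts.  For a parent p of c, N_pc exceeds N_cp by 1 or 0 according to whether
   or not the walk is currently below c, and N_cj <= N_pc for every neighbour j
   of c.  The counts out of one vertex differ by at most 1.  If u is unvisited
   and p is its parent, then N_pu = 0; climbing from p to r, the bound grows by
   at most 2 per level, so all counts out of r are at most
   2 * depth(p) + 1 <= 2H - 1, and then so are all counts N_ij.  A vertex of
   degree at most b + 1 is thus left at most (b + 1)(2H - 1) times. *)

Require Import Defs.
From mathcomp Require Import all_boot all_order all_algebra.
From mathcomp Require Import all_classical all_reals all_analysis.
From mathcomp Require Import zify.

Set Implicit Arguments.
Unset Strict Implicit.
Unset Printing Implicit Defensive.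

(** * Shortest walks in a connected graph *)

Section Distance.
Variables (V : finType) (e : rel V) (r : V).
Hypothesis e_conn : forall u v, connect e u v.

(** A connecting path shortened to one without repeated vertices has length below [#|V|], so the
    search in [gdist] succeeds before its default value. *)
Lemma walk_gdist u v : walk e u v (gdist e u v).
Proof.
have hasw : has (walk e u v) (iota 0 #|V|).
  have /connectP[p ep ->] := e_conn u v.
  case/shortenP: ep => q eq uq _.
  apply/hasP; exists (size q).
    by rewrite mem_iota /= add0n; apply: leq_trans (max_card (mem (u :: q))); rewrite (card_uniqP uq).
  by apply/existsP; exists (in_tuple q); rewrite eq eqxx.
have := nth_find 0 hasw.
by rewrite nth_iota // -[X in _ < X](size_iota 0) -has_find.
Qed.

Lemma gdist_le_walk u v n : walk e u v n -> gdist e u v <= n.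
Proof.
move=> wn; rewrite leqNgt; apply/negP => lt_n.
have ltV : n < #|V|.
  by apply: leq_trans lt_n _; rewrite -[X in _ <= X](size_iota 0) find_size.
by have := before_find 0 lt_n; rewrite nth_iota // add0n wn.
Qed.

Lemma gdist_root : gdist e r r = 0.
Proof.
apply/eqP; rewrite -leqn0; apply: gdist_le_walk.
by apply/existsP; exists [tuple]; rewrite /=.
Qed.

Lemma gdist_eq0 v : gdist e r v = 0 -> v = r.
Proof.
have := walk_gdist r v => /[swap] -> /existsP[p].
by rewrite tuple0 /= => /eqP.
Qed.

Lemma gdist_edge v w : e v w -> gdist e r w <= (gdist e r v).+1.
Proof.
move=> evw; apply: gdist_le_walk.
have /existsP[p /andP[ep /eqP lp]] := walk_gdist r v.
by apply/existsP; exists [tuple of rcons p w]; rewrite rcons_path ep lp evw last_rcons /=.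
Qed.

(** Drop the last vertex of a shortest walk. In a tree the resulting [q] is the parent of [v]. *)
Lemma gdist_pred v : v != r -> exists2 q, e q v & (gdist e r q).+1 = gdist e r v.
Proof.
move=> vr.
have /existsP[p /andP[ep /eqP lp]] := walk_gdist r v.
case: (lastP p) (size_tuple p) ep lp => [|s y] /=.
  by move=> _ _ /esym/eqP; rewrite (negPf vr).
rewrite size_rcons rcons_path last_rcons => sz /andP[es ey] yv; rewrite {y}yv in ey.
exists (last r s) => //; apply/eqP.
rewrite eqn_leq gdist_edge // andbT -sz ltnS.
by apply: gdist_le_walk; apply/existsP; exists (in_tuple s); rewrite es eqxx.
Qed.

End Distance.

(** * Subtrees, parents and degrees via edge cuts *)

Section Tree.
Variables (V : finType) (e : rel V) (r : V).
Hypothesis tree_e : is_tree e.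

Let e_sym : symmetric e. Proof. by case: tree_e. Qed.
Let e_irr : irreflexive e. Proof. by case: tree_e. Qed.
Let e_conn : forall u v, connect e u v. Proof. by case: tree_e. Qed.

Definition cut (p c : V) : rel V :=
  fun u v => e u v && ~~ ((u == p) && (v == c) || (u == c) && (v == p)).

(** For a child [c] of [p], this is the subtree below [c]. *)
Definition side (p c : V) : pred V := connect (cut p c) c.

Lemma cut_sym p c : symmetric (cut p c).
Proof.
move=> u v; rewrite /cut e_sym orbC.
by congr (_ && ~~ (_ || _)); rewrite andbC.
Qed.

Lemma side_src p c : side p c c.
Proof. exact: connect0. Qed.

(** A duplicate-free path from [c] to [p] closes up along the edge to a cycle, so it has at most two
    vertices. It is then trivial, against irreflexivity, or it is the cut edge itself. *)
Lemma side_tgt p c : e p c -> ~~ side p c p.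
Proof.
move=> epc; apply/negP => /connectP[s es].
case/shortenP: es => q eq uq _ pq.
have eq' : path e c q by apply: sub_path eq => u v /andP[].
have cyc : ucycle e (c :: q) by rewrite /ucycle uq /= rcons_path eq' -pq epc.
have [_ _ _ /(_ _ cyc)] := tree_e.
case: q pq {cyc eq' uq} eq => [|y [|//]] /= pq.
  by rewrite pq e_irr in epc.
by rewrite -pq /cut !eqxx orbT andbF.
Qed.

Lemma side_edge p c u v : e u v ->
  ~~ ((u == p) && (v == c) || (u == c) && (v == p)) -> side p c u = side p c v.
Proof.
move=> euv nuv; rewrite /side.
have cuv : cut p c u v by rewrite /cut euv.
exact: (same_connect1r (sym_connect_sym (cut_sym p c))).
Qed.

(* A geodesic from the root to [u] cannot use an edge whose far end [c] is at
   least as deep as [u]. *)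
Lemma side_shallow p c u : e p c -> gdist e r c = (gdist e r p).+1 ->
  gdist e r u <= gdist e r c -> u != c -> side p c u = side p c r.
Proof.
move=> epc dc; elim: {u}(gdist e r u) {-2}u (erefl (gdist e r u)) => [|n IH] u du.
  by move=> _ _; rewrite (gdist_eq0 e_conn du).
move=> le_uc uc.
have ur : u != r by apply: contraPneq du => ->; rewrite gdist_root.
have [q equ dq] := gdist_pred e_conn ur.
have qc : q != c by apply: contraTneq le_uc => qc; rewrite -dq qc ltnn.
rewrite -(IH q) //; [|lia|lia].
by apply/esym/side_edge; rewrite // (negPf uc) (negPf qc) andbF.
Qed.

Lemma side_root p c : e p c -> gdist e r c = (gdist e r p).+1 -> ~~ side p c r.
Proof.
move=> epc dc; rewrite -(side_shallow epc dc (u := p)) ?side_tgt //; first by rewrite dc.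
by apply: contraTneq epc => ->; rewrite e_irr.
Qed.

(** Any other such [w] would lie on the side of [v] because of the edge from [v], yet on the side of
    the root because of its depth. *)
Lemma nonchild_unique p v w : e p v -> gdist e r v = (gdist e r p).+1 ->
  e v w -> gdist e r w <= gdist e r v -> w = p.
Proof.
move=> epv dv evw le_wv; apply/eqP; apply: contraT => wp.
have wv : w != v by apply: contraTneq evw => ->; rewrite e_irr.
have := side_root epv dv.
rewrite -(side_shallow epv dv le_wv wv) -(side_edge (u := v)) ?side_src // (negPf wp) (negPf wv).
by rewrite !andbF.
Qed.

Lemma neighbours_root : [set w | e r w]%SET = children e r r.
Proof.
apply/setP => w; rewrite !inE; case erw: (e r w) => //=; apply/esym/eqP/anti_leq.
rewrite gdist_edge // gdist_root lt0n; apply: contraTneq erw => /(gdist_eq0 e_conn) ->.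
by rewrite e_irr.
Qed.

Lemma neighbours_sub v p : e p v -> gdist e r v = (gdist e r p).+1 ->
  ([set w | e v w] \subset p |: children e r v)%SET.
Proof.
move=> epv dv; apply/fintype.subsetP => w; rewrite !inE => evw; rewrite evw /=.
have [le_wv|lt_vw] := leqP (gdist e r w) (gdist e r v).
  by rewrite (nonchild_unique epv dv evw le_wv) eqxx.
by rewrite [X in _ || X]eqn_leq lt_vw gdist_edge // orbT.
Qed.

Lemma degree_le b v : (forall v, ~~ leaf e r v -> #|children e r v| <= b) ->
  #|[set w | e v w]%SET| <= b.+1.
Proof.
move=> children_le.
have le_b : #|children e r v| <= b.
  by have [/eqP ->|/children_le //] := boolP (leaf e r v); rewrite cards0.
have [->|vr] := eqVneq v r.
  rewrite neighbours_root; have [/eqP ->|/children_le/leqW //] := boolP (leaf e r r).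
  by rewrite cards0.
have [p epv /esym dv] := gdist_pred e_conn vr.
apply: leq_trans (subset_leq_card (neighbours_sub epv dv)) _.
by rewrite cardsU1; lia.
Qed.

End Tree.

(** * Crossing and visit counts of an arbitrary trajectory *)

Section Counting.
Variables (V : finType) (x : nat -> V).

Lemma crossings0 i j : crossings x 0 i j = 0.
Proof. by apply/eqP; rewrite cards_eq0; apply/eqP/setP => -[]. Qed.

Lemma crossingsE m i j :
  crossings x m i j = \sum_(t < m) ((x t == i) && (x t.+1 == j)).
Proof. by rewrite /crossings -sum1dep_card big_mkcond. Qed.

Lemma crossingsS m i j : crossings x m.+1 i j =
  crossings x m i j + ((x m == i) && (x m.+1 == j)).
Proof. by rewrite !crossingsE big_ord_recr. Qed.

Lemma visitsE m v : visits x m v = \sum_(t < m.+1) (x t == v).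
Proof. by rewrite /visits -sum1dep_card big_mkcond. Qed.

(** Each visit before time [m] is followed by exactly one counted step out of [v]; a visit at time
    [m] itself is not. *)
Lemma visits_crossings m v :
  visits x m v = \sum_j crossings x m v j + (x m == v).
Proof.
rewrite visitsE big_ord_recr /=; congr (_ + _).
under [RHS]eq_bigr do rewrite crossingsE.
rewrite exchange_big; apply: eq_bigr => t _ /=.
rewrite (bigD1 (x t.+1)) //= eqxx andbT big1 ?addn0 // => j jx.
by rewrite [_ == j]eq_sym (negPf jx) andbF.
Qed.

End Counting.

Lemma eq_crossings (V : finType) (x y : nat -> V) m i j :
  (forall t, t <= m -> x t = y t) -> crossings x m i j = crossings y m i j.
Proof.
move=> xy; apply: eq_card => t; rewrite !inE xy ?(ltnW (ltn_ord t)) //.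
by rewrite xy ?ltn_ord.
Qed.

(** Allows a random trajectory to be replaced by a finite list of its first values when the options
    for the next step are computed. *)
Lemma eq_Smin (V : finType) (e : rel V) (x y : nat -> V) m i :
  (forall t, t <= m -> x t = y t) -> Smin e x m i = Smin e y m i.
Proof.
move=> xy; apply/setP => j; rewrite !inE; congr (_ && _).
by apply: eq_forallb => k; rewrite !(eq_crossings _ _ xy).
Qed.

(** * Deterministic bounds along a walk that always moves within [Smin] *)

Section Trajectory.
Variables (V : finType) (e : rel V) (r : V) (x : nat -> V).
Hypothesis tree_e : is_tree e.
Hypothesis x0 : x 0 = r.
Hypothesis step : forall m, x m.+1 \in Smin e x m (x m).

Let e_sym : symmetric e. Proof. by case: tree_e. Qed.
Let e_irr : irreflexive e. Proof. by case: tree_e. Qed.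
Let e_conn : forall u v, connect e u v. Proof. by case: tree_e. Qed.

Lemma step_edge m : e (x m) (x m.+1).
Proof. by have := step m; rewrite inE => /andP[]. Qed.

Lemma step_min m k : e (x m) k ->
  crossings x m (x m) (x m.+1) <= crossings x m (x m) k.
Proof. by have := step m; rewrite inE => /andP[_ /forallP/(_ k)/implyP]. Qed.

(** The count of [i -> j] grows only at a time when it is minimal among the counts out of [i]. *)
Lemma crossings_balanced m i j k : e i j -> e i k ->
  crossings x m i j <= (crossings x m i k).+1.
Proof.
move=> eij eik; elim: m => [|m IH]; first by rewrite !crossings0.
rewrite !crossingsS; have [xi|_] := eqVneq (x m) i; last by rewrite !addn0.
have := @step_min m k; rewrite xi => /(_ eik).
by have [->|_] := eqVneq (x m.+1) j; lia.
Qed.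

(** The walk starts outside the subtree below [c] and enters or leaves it only along this edge, so
    entries exceed exits by one exactly while it is inside. *)
Lemma crossings_flow m p c : e p c -> gdist e r c = (gdist e r p).+1 ->
  crossings x m p c = crossings x m c p + side e p c (x m).
Proof.
move=> epc dc.
have sp := negPf (side_tgt tree_e epc).
have sc := side_src e p c.
elim: m => [|m IH]; first by rewrite !crossings0 x0 (negPf (side_root tree_e epc dc)).
rewrite !crossingsS IH.
have pc : p == c = false by apply: contraTF epc => /eqP ->; rewrite e_irr.
case/boolP: ((x m == p) && (x m.+1 == c)) => [/andP[/eqP -> /eqP ->]|n1].
  by rewrite sp sc pc /=; lia.
case/boolP: ((x m == c) && (x m.+1 == p)) => [/andP[/eqP -> /eqP ->]|n2].
  by rewrite sp sc /=; lia.
rewrite (side_edge tree_e (step_edge m)) ?(negPf n1) ?(negPf n2) //=; lia.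
Qed.

(* Leaving [c] for [j] requires that [c -> j] was at most as used as [c -> p],
   and while the walk is at [c] the edge [p -> c] is one ahead of [c -> p]. *)
Lemma crossings_descend m p c j : e p c -> gdist e r c = (gdist e r p).+1 ->
  e c j -> crossings x m c j <= crossings x m p c.
Proof.
move=> epc dc ecj; elim: m => [|m IH]; first by rewrite !crossings0.
rewrite !crossingsS; have [xc|_] := eqVneq (x m) c; last by rewrite addn0; lia.
have [xj|_] := eqVneq (x m.+1) j; last by rewrite addn0; lia.
have ecp : e c p by rewrite e_sym.
have := @step_min m p; rewrite xc xj => /(_ ecp).
by have := crossings_flow m epc dc; rewrite xc side_src; lia.
Qed.

(** With [q] the parent of [p], passing from [p -> v] to [p -> q] costs 1 by balance, and from there
    to [q -> p] costs 1 by flow. The last 1 is balance among the edges out of [r]. *)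
Lemma crossings_climb m a p v j : e p v -> gdist e r v = (gdist e r p).+1 ->
  crossings x m p v <= a -> e r j ->
  crossings x m r j <= a + (2 * gdist e r p).+1.
Proof.
move=> epv dv le_a erj.
elim: {p}(gdist e r p) {-2}p (erefl (gdist e r p)) v a epv dv le_a
  => [|n IH] p dp v a epv dv le_a.
  rewrite (gdist_eq0 e_conn dp) in epv le_a.
  by have := crossings_balanced m erj epv; lia.
have pr : p != r by apply: contraPneq dp => ->; rewrite gdist_root.
have [q eqp dq] := gdist_pred e_conn pr.
have epq : e p q by rewrite e_sym.
have := crossings_balanced m epq epv.
have := crossings_flow m eqp (esym dq).
have nq : gdist e r q = n by lia.
move=> fl bal; have := IH q nq p a.+2 eqp (esym dq).
have le2 : crossings x m q p <= a.+2 by case: (side e q p (x m)) fl => /= fl; lia.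
by move=> /(_ le2); lia.
Qed.

(** Iterate [crossings_descend] from [i] up to the root. *)
Lemma crossings_le_root m a i j :
  (forall k, e r k -> crossings x m r k <= a) -> e i j -> crossings x m i j <= a.
Proof.
move=> le_a.
elim: {i}(gdist e r i) {-2}i (erefl (gdist e r i)) j => [|n IH] i di j eij.
  by rewrite (gdist_eq0 e_conn di) in eij *; apply: le_a.
have ir : i != r by apply: contraPneq di => ->; rewrite gdist_root.
have [q eqi dq] := gdist_pred e_conn ir.
apply: leq_trans (crossings_descend m eqi (esym dq) eij) _.
by apply: IH => //; lia.
Qed.

Lemma crossings_nonneighbour m i j : ~~ e i j -> crossings x m i j = 0.
Proof.
move=> nij; rewrite crossingsE big1 // => t _.
by case: andP => // -[/eqP xi /eqP xj]; rewrite -xi -xj step_edge in nij.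
Qed.

Lemma visits_le b m v :
  (forall v, ~~ leaf e r v -> #|children e r v| <= b) ->
  ~~ covered x m -> visits x m v <= 2 * (b + 1) * tree_depth e r.
Proof.
move=> children_le; rewrite negb_forall => /existsP[u].
rewrite -eqn0Ngt visitsE sum_nat_eq0 => /forallP nu.
have ur : u != r by have := nu ord0; rewrite /= x0 eqb0 eq_sym.
have [p epu dp] := gdist_pred e_conn ur.
(* A crossing at time [t < m] reaches [u] at time [t.+1 <= m], which [visits] still counts; hence
   the index [lift ord0 t]. *)
have pu0 : crossings x m p u <= 0.
  rewrite crossingsE leqn0 sum_nat_eq0; apply/forallP => t /=.
  have := nu (lift ord0 t); rewrite /= /bump /= add1n !eqb0 => /negPf ->.
  by rewrite andbF.
have du : gdist e r u <= tree_depth e r by apply: (leq_bigmax u).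
have bound i j : e i j -> crossings x m i j <= (2 * gdist e r p).+1.
  by apply: crossings_le_root => k; apply: (crossings_climb epu (esym dp) pu0).
have sum_le : \sum_j crossings x m v j <= b.+1 * (2 * gdist e r p).+1.
  rewrite (bigID [in [set w | e v w]%SET]) /= [X in _ + X]big1 ?addn0; last first.
    by move=> j; rewrite inE; apply: crossings_nonneighbour.
  apply: leq_trans (_ : \sum_(j in [set w | e v w]%SET) (2 * gdist e r p).+1 <= _).
    by apply: leq_sum => j; rewrite inE; apply: bound.
  by rewrite sum_nat_const leq_mul2r (degree_le (r := r)) ?orbT.
(* As [p] has depth at most [H - 1], with [H] the tree depth, the total is at most
   [(b + 1)(2H - 1) + 1]. The final 1, for time [m], is absorbed since [b + 1 >= 1]. *)
rewrite visits_crossings; apply: leq_trans (leq_add sum_le (leq_b1 _)) _.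
by rewrite -dp in du; nia.
Qed.

End Trajectory.

(** * From conditional probabilities to almost sure trajectories *)

Lemma measurable_past (d : measure_display) (Omega : measurableType d)
    (V : finType) (X : nat -> Omega -> V) m x :
  (forall m v, measurable [set w | X m w = v]%classic) ->
  measurable (past X m x).
Proof.
move=> mX.
have -> : past X m x =
    (\bigcap_(t in [set t | (t <= m)%N]) [set w | X t w = x t])%classic by [].
by apply: bigcap_measurable => [|t _]; [exists 0 | apply: mX].
Qed.

Lemma ae_forall_countable (d : measure_display) (Omega : measurableType d)
    (R : realType) (mu : measure Omega R) (I : countType)
    (Q : I -> Omega -> Prop) :
  (forall i, {ae mu, forall w, Q i w}) -> {ae mu, forall w i, Q i w}.
Proof.
move=> aeQ.
have aeQn n : {ae mu, forall w, if choice.unpickle n is Some i then Q i w else True}.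
  by case: choice.unpickle => [i|]; [exact: aeQ | exact: aeW].
apply: filterS (ae_foralln aeQn) => w Qw i.
by have := Qw (choice.pickle i); rewrite choice.pickleK.
Qed.

(** Each finite history followed by a forbidden next vertex is a null event, and there are only
    countably many such pairs. *)
Lemma ae_step (V : finType) (e : rel V) (r : V) (R : realType)
    (d : measure_display) (Omega : measurableType d) (P : probability Omega R)
    (X : nat -> Omega -> V) :
  negative_feedback P e r X ->
  {ae P, forall w m, let x := fun t => X t w in
     Smin e x m (x m) != finset.set0 -> x m.+1 \in Smin e x m (x m)}.
Proof.
move=> [mX _ nf].
(* Histories are lists, which form a countable type, unlike functions on [nat]. Beyond its end a
   list is padded with [r], which affects neither [past] nor [Smin] at time [m]. *)
pose bad (hj : seq V * V) :=
  let x := nth r hj.1 in let m := (size hj.1).-1 in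
  ([set w | X m.+1 w = hj.2] `&` past X m x)%classic.
pose good (hj : seq V * V) :=
  let x := nth r hj.1 in let m := (size hj.1).-1 in
  Smin e x m (x m) != finset.set0 -> hj.2 \in Smin e x m (x m).
have ae_good hj : {ae P, forall w, bad hj w -> good hj}.
  case: hj => h j; rewrite /bad /good /=; set x := nth r h; set m := (size h).-1.
  have [jS|jS] := boolP (j \in Smin e x m (x m)); first exact: aeW.
  have [S0|S0] := eqVneq (Smin e x m (x m)) finset.set0; first exact: aeW.
  have mpast : measurable (past X m x) by apply: measurable_past.
  have mbad : measurable ([set w | X m.+1 w = j] `&` past X m x)%classic.
    by apply: measurableI.
  have P0 : P ([set w | X m.+1 w = j] `&` past X m x)%classic = 0%E.
    have [p0|p0] := eqVneq (P (past X m x)) 0%E.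
      by apply: subset_measure0 p0 => // w [].
    (* The quotient vanishes, so its numerator or its denominator does; the latter contradicts
       [p0]. *)
    have /eqP := nf m x j p0 S0.
    rewrite (negPf jS) /cprob GRing.mulf_eq0 GRing.invr_eq0 => /orP[] /eqP f0.
      by rewrite -[LHS]fineK ?f0 ?fin_num_measure.
    by case/eqP: p0; rewrite -[LHS]fineK ?f0 ?fin_num_measure.
  exists ([set w | X m.+1 w = j] `&` past X m x)%classic; split => // w /= nw.
  by apply: contrapT => nb; apply: nw.
apply: filterS (ae_forall_countable ae_good) => w good_w m.
set x := fun t => X t w; move=> S0.
have [h sz_h hx] : exists2 h, size h = m.+1 & forall t, t <= m -> nth r h t = x t.
  by exists (mkseq x m.+1) => [|t tm]; rewrite ?size_mkseq ?nth_mkseq.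
have := good_w (h, x m.+1); rewrite /bad /good /= sz_h /=.
rewrite (eq_Smin _ _ hx) hx // => good_m; apply: good_m => //.
by split=> // t tm; rewrite hx.
Qed.

Lemma Smin_neq0 (V : finType) (e : rel V) (x : nat -> V) m i j :
  e i j -> Smin e x m i != finset.set0.
Proof.
move=> eij; apply/set0Pn.
have [k eik min_k] := arg_minnP (crossings x m i) eij.
by exists k; rewrite inE eik; apply/forallP => l; apply/implyP/min_k.
Qed.

Theorem theorem7 (V : finType) (e : rel V) (r : V) (b H : nat)
  (tree_e : is_tree e)
  (depth_e : tree_depth e r = H)
  (children_le : forall v : V, ~~ leaf e r v -> #|children e r v| <= b)
  (R : realType) (d : measure_display) (Omega : measurableType d)
  (P : probability Omega R) (X : nat -> Omega -> V)
  (nf_X : negative_feedback P e r X) :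
  {ae P, forall w : Omega, forall (m : nat) (v : V),
     ~~ covered (fun t => X t w) m ->
     visits (fun t => X t w) m v <= 2 * (b + 1) * H}.
Proof.
have [_ X0 _] := nf_X; have [_ _ e_conn _] := tree_e.
apply: filterS2 X0 (ae_step nf_X) => w; set x := fun t => X t w => x0 step_w m v ncov.
(* Since [r] is visited at time 0, an uncovered time rules out the one-vertex tree. By connectivity
   every vertex then has a neighbour, so [Smin] is never empty. *)
have [u ur] : exists u, u != r.
  move: ncov; rewrite negb_forall => /existsP[u nu]; exists u.
  apply: contraNneq nu => ->; rewrite visitsE (bigD1 ord0) //=.
  by rewrite /x x0 eqxx.
have has_neighbour i : exists j, e i j.
  have [->|ir] := eqVneq i r.
    have /connectP[[|j s] /=] := e_conn r u; first by move=> _ ru; rewrite ru eqxx in ur.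
    by case/andP=> erj _ _; exists j.
  have /connectP[[|j s] /=] := e_conn i r; first by move=> _ ri; rewrite ri eqxx in ir.
  by case/andP=> eij _ _; exists j.
rewrite -depth_e; apply: visits_le ncov => // k.
by apply: step_w; have [j] := has_neighbour (x k); apply: Smin_neq0.
Qed.
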